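(* For all integers $n \ge 2$ and all primes $p$, there exists a finite-index normal subgroup $R \lhd F_n$ such that $H_1^{\mathfrak{O}_p}(R;\mathbb{Q}) \neq H_1(R;\mathbb{Q})$. Moreover, $R$ can be chosen such that $F_n/R$ is a $p$-group.
   Context: $F_n$ is the free group on $n$ generators and $\mathbb{F}_p$ is the field with $p$ elements. An element $x \in F_n$ is $p$-primitive if it maps to a nonzero element of $H_1(F_n;\mathbb{F}_p)$; $\mathfrak{O}_p \subset F_n$ denotes the set of $p$-primitive elements. For a finite-index subgroup $R < F_n$, $H_1^{\mathfrak{O}_p}(R;\mathbb{Q})$ is the $\mathbb{Q}$-span in $H_1(R;\mathbb{Q})$ of the set of all classes $[x^k] \in H_1(R;\mathbb{Q})$ such that $x \in \mathfrak{O}_p$ and $k \ge 1$ is such that $x^k \in R$. *)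

(* Defs.v *)
From HB Require Import structures.
From mathcomp Require Import all_boot all_order all_algebra.
From mathcomp Require Import finmap.
From mathcomp Require Import boolp classical_sets cardinality.
From mathcomp.multinomials Require Import monalg.

Set Implicit Arguments.
Unset Strict Implicit.
Unset Printing Implicit Defensive.

Local Open Scope classical_set_scope.
Local Open Scope group_scope.

(* The free group on a set X of generators, as reduced words.  The letter     *)
(* (x, false) stands for the generator x and (x, true) for its inverse.       *)

Section FreeGroup.
Variable X : choiceType.

Definition inv_letter (a : X * bool) : X * bool := (a.1, ~~ a.2).

Definition reduced (w : seq (X * bool)) : bool :=
  sorted (fun a b => b != inv_letter a) w.

Record free_group : predArgType :=
  FreeWord { free_word :> seq (X * bool); _ : reduced free_word }.

HB.instance Definition _ := [isSub for free_word].
HB.instance Definition _ := [Choice of free_group by <:].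

Definition push (a : X * bool) (w : seq (X * bool)) : seq (X * bool) :=
  if w is b :: w' then if b == inv_letter a then w' else a :: w else [:: a].

Lemma inv_letterK : involutive inv_letter.
Proof. by case=> x b; rewrite /inv_letter /= negbK. Qed.

Lemma reduced_behead a w : reduced (a :: w) -> reduced w.
Proof. by case: w => //= b w /andP[]. Qed.

Lemma push_reduced a w : reduced w -> reduced (push a w).
Proof.
case: w => //= b w rw; case: ifPn => [_|nb]; first exact: reduced_behead rw.
by rewrite /reduced /= nb.
Qed.

Lemma push_cons a w : reduced (a :: w) -> push a w = a :: w.
Proof. by case: w => //= b w /andP[/negbTE->]. Qed.

Lemma push_invK a w : reduced w -> push a (push (inv_letter a) w) = w.
Proof.
case: w => [|b w] rw /=; first by rewrite eqxx.
rewrite inv_letterK; case: eqP => [<-|/eqP nb]; first exact: push_cons.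
by rewrite /= eqxx.
Qed.

Lemma push_Kinv a w : reduced w -> push (inv_letter a) (push a w) = w.
Proof. by move=> rw; rewrite -{2}(inv_letterK a) push_invK. Qed.

Lemma foldr_push_reduced u w : reduced w -> reduced (foldr push w u).
Proof. by move=> rw; elim: u => //= a u; apply: push_reduced. Qed.

Lemma foldr_push_nil u : reduced u -> foldr push [::] u = u.
Proof.
elim: u => //= a u IHu ru.
by rewrite IHu ?push_cons //; apply: reduced_behead ru.
Qed.

Lemma foldr_push_push a v w : reduced v -> reduced w ->
  foldr push w (push a v) = push a (foldr push w v).
Proof.
case: v => //= b v rv rw; case: eqP => [->|_] //.
by rewrite push_invK //; apply: foldr_push_reduced.
Qed.

Lemma foldr_push_assoc u v w : reduced v -> reduced w ->
  foldr push w (foldr push v u) = foldr push (foldr push w v) u.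
Proof.
move=> rv rw; elim: u => //= a u <-.
by rewrite foldr_push_push //; apply: foldr_push_reduced.
Qed.

Definition inv_word (w : seq (X * bool)) : seq (X * bool) :=
  rev (map inv_letter w).

Lemma inv_wordK : involutive inv_word.
Proof.
by move=> w; rewrite /inv_word map_rev revK -map_comp map_id_in // => a _ /=;
   rewrite inv_letterK.
Qed.

Lemma inv_word_reduced w : reduced w -> reduced (inv_word w).
Proof.
rewrite /reduced /inv_word rev_sorted sorted_map; apply: sub_sorted => a b /=.
by rewrite inv_letterK eq_sym.
Qed.

Lemma foldr_push_inv u w : reduced w ->
  foldr push (foldr push w u) (inv_word u) = w.
Proof.
elim: u w => //= a u IHu w rw.
rewrite /inv_word /= rev_cons -cats1 foldr_cat /= push_Kinv ?IHu //.
exact: foldr_push_reduced.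
Qed.

Definition free_one : free_group := @FreeWord [::] isT.

Definition free_mul (u v : free_group) : free_group :=
  FreeWord (foldr_push_reduced u (valP v)).

Definition free_inv (u : free_group) : free_group :=
  FreeWord (inv_word_reduced (valP u)).

Lemma free_mulA : associative free_mul.
Proof.
move=> u v w; apply: val_inj => /=.
by rewrite foldr_push_assoc ?(valP v) ?(valP w).
Qed.

Lemma free_mul1 : left_id free_one free_mul.
Proof. by move=> u; apply: val_inj. Qed.

Lemma free_mulr1 : right_id free_one free_mul.
Proof. by move=> u; apply: val_inj; apply: foldr_push_nil (valP u). Qed.

Lemma free_mulV : left_inverse free_one free_inv free_mul.
Proof.
move=> u; apply: val_inj => /=.
by rewrite -[X in foldr _ X _](foldr_push_nil (valP u)) foldr_push_inv.
Qed.

Lemma free_mulrV : right_inverse free_one free_inv free_mul.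
Proof.
move=> u; have {1}<- : free_inv (free_inv u) = u; last exact: free_mulV.
by apply: val_inj; rewrite /= inv_wordK.
Qed.

HB.instance Definition _ := isGroup.Build free_group
  free_mulA free_mul1 free_mulr1 free_mulV free_mulrV.

Definition free_gen (x : X) : free_group := @FreeWord [:: (x, false)] isT.

Section Lift.
Variables (G : groupType) (f : X -> G).

Definition free_eval_letter (a : X * bool) : G :=
  if a.2 then (f a.1)^-1 else f a.1.

Definition free_lift (w : free_group) : G :=
  \prod_(a <- free_word w) free_eval_letter a.

Lemma free_lift_gen x : free_lift (free_gen x) = f x.
Proof. by rewrite /free_lift big_seq1. Qed.

Lemma free_liftM : {morph free_lift : u v / u * v}.
Proof.
move=> u v; rewrite /free_lift /=; elim: (free_word u) => [|a s IHs] /=.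
  by rewrite big_nil mul1g.
rewrite big_cons -mulgA -IHs; case: (foldr _ _ s) => [|b t] /=.
  by rewrite big_seq1 big_nil mulg1.
case: eqP => [->|_]; last by rewrite big_cons.
rewrite big_cons mulgA; case: a => x [] /=; rewrite /free_eval_letter /=.
- by rewrite mulVg mul1g.
- by rewrite mulgV mul1g.
Qed.

Lemma free_lift_unique (g : free_group -> G) :
  {morph g : u v / u * v} -> (forall x, g (free_gen x) = f x) ->
  forall w, g w = free_lift w.
Proof.
move=> gM gx.
have g1 : g 1 = 1 by apply: (mulgI (g 1)); rewrite -gM !mulg1.
have gV u : g u^-1 = (g u)^-1.
  by apply: (mulgI (g u)); rewrite -gM !mulgV.
case=> s rs; rewrite /free_lift /=; elim: s rs => [|a s IHs] rs.
  by rewrite big_nil -g1; congr g; apply: val_inj.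
have rs' := reduced_behead rs.
rewrite big_cons -(IHs rs').
have ra : reduced [:: a] by [].
have -> : FreeWord rs = FreeWord ra * FreeWord rs'.
  by apply: val_inj; rewrite /= push_cons.
rewrite gM; congr (_ * _); case: a {rs} ra => x [] ra.
- by rewrite /free_eval_letter /= -gx -gV; congr g; apply: val_inj.
- by rewrite /free_eval_letter /= -gx; congr g; apply: val_inj.
Qed.

End Lift.
End FreeGroup.

Section Subgroups.
Variables (G : groupType) (R : groupClosed G).

Definition subgroup : predArgType := {x : G | x \in R}.

HB.instance Definition _ := SubChoice.on subgroup.

Lemma subgroup_group_closed : group_closed [pred x : G | x \in R].
Proof.
split; first exact: gpred1.
by move=> x y xR yR; apply: gpredM => //; apply: gpredVr.
Qed.

HB.instance Definition _ :=
  SubChoice_isSubGroup.Build G _ subgroup subgroup_group_closed.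

Definition normal_subgroup : Prop :=
  forall x y : G, x \in R -> x ^ y \in R.

Definition lcosets : set (set G) :=
  range (fun g : G => [set g * x | x in [set x : G | x \in R]]).

Definition finite_index : Prop := finite_set lcosets.

(* Meant for R normal, when lcosets is the underlying set of G / R.           *)
Definition pgroup_quotient (p : nat) : Prop :=
  exists2 m : nat, (lcosets #= `I_m)%card & p.-nat m.

End Subgroups.

Local Open Scope ring_scope.
Import GRing.Theory.

Section Span.
Variables (K : nzRingType) (V : lmodType K).

Definition lspan (A : set V) : set V :=
  [set v | exists (m : nat) (a : 'I_m -> K) (x : 'I_m -> V),
     (forall i, A (x i)) /\ v = \sum_(i < m) a i *: x i].

Lemma lspan0 A : lspan A 0.
Proof.
exists 0%N, (fun=> 0), (fun=> 0); split; first by case.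
by rewrite big_ord0.
Qed.

Lemma lspanD A u v : lspan A u -> lspan A v -> lspan A (u + v).
Proof.
move=> [m [a [x [Ax ->]]]] [m' [a' [x' [Ax' ->]]]].
exists (m + m')%N, (fun i => match split i with inl j => a j | inr j => a' j end).
exists (fun i => match split i with inl j => x j | inr j => x' j end).
split; first by move=> i; case: (split i).
rewrite big_split_ord /=; congr (_ + _); apply: eq_bigr => i _.
- by rewrite (unsplitK (inl i)).
- by rewrite (unsplitK (inr i)).
Qed.

Lemma lspanZ A c v : lspan A v -> lspan A (c *: v).
Proof.
move=> [m [a [x [Ax ->]]]]; exists m, (fun i => c * a i), x; split=> //.
by rewrite scaler_sumr; apply: eq_bigr => i _; rewrite scalerA.
Qed.

Lemma lspanN A v : lspan A v -> lspan A (- v).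
Proof. by rewrite -scaleN1r; apply: lspanZ. Qed.

End Span.

Section LmodQuotient.
Local Open Scope quotient_scope.
Variables (K : nzRingType) (V : lmodType K) (A : set V).

Definition lspan_rel : rel V := fun u v => `[< lspan A (u - v) >].

Lemma lspan_rel_equiv : equiv_class_of lspan_rel.
Proof.
split=> [u|u v|v u w].
- by apply/asboolP; rewrite subrr; apply: lspan0.
- by apply/asboolP/asboolP => /lspanN; rewrite opprB.
- move=> /asboolP uv /asboolP vw; apply/asboolP.
  by rewrite -(subrK v u) -addrA; apply: lspanD.
Qed.

Canonical lspan_equiv := EquivRelPack lspan_rel_equiv.

Definition quot_lspan := {eq_quot lspan_equiv}.

HB.instance Definition _ := Choice.on quot_lspan.
HB.instance Definition _ := EqQuotient.on quot_lspan.

Definition quot_proj (v : V) : quot_lspan := \pi_quot_lspan v.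

Lemma quot_projP u v : quot_proj u = quot_proj v <-> lspan A (u - v).
Proof.
split; first by move/eqP; rewrite /quot_proj eqmodE => /asboolP.
by move=> uv; apply/eqP; rewrite /quot_proj eqmodE; apply/asboolP.
Qed.

Lemma quot_reprK q : quot_proj (repr q) = q.
Proof. exact: reprK. Qed.

Lemma quot_projK v : lspan A (repr (quot_proj v) - v).
Proof. by apply/quot_projP; rewrite quot_reprK. Qed.

Definition quot_add (q r : quot_lspan) := quot_proj (repr q + repr r).
Definition quot_opp (q : quot_lspan) := quot_proj (- repr q).
Definition quot_scale (c : K) (q : quot_lspan) := quot_proj (c *: repr q).

Lemma quot_addE u v : quot_add (quot_proj u) (quot_proj v) = quot_proj (u + v).
Proof. by apply/quot_projP; rewrite opprD addrACA; apply: lspanD; apply: quot_projK. Qed.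

Lemma quot_oppE u : quot_opp (quot_proj u) = quot_proj (- u).
Proof. by apply/quot_projP; rewrite -opprD; apply/lspanN/quot_projK. Qed.

Lemma quot_scaleE c u : quot_scale c (quot_proj u) = quot_proj (c *: u).
Proof. by apply/quot_projP; rewrite -scalerBr; apply/lspanZ/quot_projK. Qed.

Lemma quot_addA : associative quot_add.
Proof.
move=> q r s; rewrite -(quot_reprK q) -(quot_reprK r) -(quot_reprK s).
by rewrite !quot_addE addrA.
Qed.

Lemma quot_addC : commutative quot_add.
Proof. by move=> q r; rewrite /quot_add addrC. Qed.

Lemma quot_add0 : left_id (quot_proj 0) quot_add.
Proof. by move=> q; rewrite -(quot_reprK q) quot_addE add0r. Qed.

Lemma quot_addN : left_inverse (quot_proj 0) quot_opp quot_add.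
Proof. by move=> q; rewrite -(quot_reprK q) quot_oppE quot_addE addNr. Qed.

HB.instance Definition _ :=
  GRing.isZmodule.Build quot_lspan quot_addA quot_addC quot_add0 quot_addN.

Lemma quot_scaleA a b q : quot_scale a (quot_scale b q) = quot_scale (a * b) q.
Proof. by rewrite -(quot_reprK q) !quot_scaleE scalerA. Qed.

Lemma quot_scale1 : left_id 1 quot_scale.
Proof. by move=> q; rewrite -(quot_reprK q) quot_scaleE scale1r. Qed.

Lemma quot_scaleDr : right_distributive quot_scale +%R.
Proof.
move=> c q r; rewrite -(quot_reprK q) -(quot_reprK r).
by rewrite /GRing.add /= quot_addE !quot_scaleE quot_addE scalerDr.
Qed.

Lemma quot_scaleDl q : {morph quot_scale^~ q : a b / a + b}.
Proof.
move=> a b; rewrite -(quot_reprK q) [RHS]/GRing.add /=.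
by rewrite !quot_scaleE quot_addE scalerDl.
Qed.

HB.instance Definition _ := GRing.Zmodule_isLmodule.Build K quot_lspan
  quot_scaleA quot_scale1 quot_scaleDr quot_scaleDl.

Lemma quot_proj_is_linear : linear quot_proj.
Proof.
by move=> c u v; rewrite /GRing.scale /GRing.add /= quot_scaleE quot_addE.
Qed.

HB.instance Definition _ :=
  GRing.isLinear.Build K V quot_lspan _ quot_proj quot_proj_is_linear.

End LmodQuotient.

(* First homology with trivial coefficients, computed from the bar complex    *)
(* C_2 -> C_1 -> C_0: here C_1 is free on the symbols [g], the boundary       *)
(* C_1 -> C_0 is zero, and the boundaries [h] - [g h] + [g] span B_1.         *)

Section H1.
Variables (K : fieldType) (G : groupType).

Definition bar_chain1 : lmodType K := {malg K[G]}.

Definition bar_gen (g : G) : bar_chain1 := mkmalgU g 1.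

Definition bar_boundaries : set bar_chain1 :=
  [set bar_gen gh.2 - bar_gen (gh.1 * gh.2)%g + bar_gen gh.1 | gh in [set: G * G]].

Definition H1 : lmodType K := quot_lspan bar_boundaries.

Definition H1_class (g : G) : H1 := quot_proj bar_boundaries (bar_gen g).

Lemma H1_classM g h : H1_class (g * h)%g = H1_class g + H1_class h.
Proof.
apply/esym; rewrite /H1_class -linearD; apply/quot_projP.
exists 1%N, (fun=> 1), (fun=> bar_gen h - bar_gen (g * h)%g + bar_gen g).
split; first by move=> _; exists (g, h).
by rewrite big_ord1 scale1r [RHS]addrC addrA.
Qed.

End H1.

Definition p_primitive (n p : nat) (x : free_group 'I_n) : Prop :=
  H1_class 'F_p x != 0.

Definition H1_primitive (n p : nat) (R : groupClosed (free_group 'I_n)) :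
    set (H1 rat (subgroup R)) :=
  lspan [set c | exists (x : free_group 'I_n) (k : nat) (xkR : (x ^+ k)%g \in R),
     [/\ p_primitive p x, (1 <= k)%N
       & c = H1_class rat (Sub (x ^+ k)%g xkR : subgroup R)]].

Arguments H1_primitive [n] p R _.

(* Main.v *)
(* Suppose that rho : F_n -> P is a homomorphism to a finite p-group and z in P *)
(* has order p, commutes with rho(F_n), and is a power of rho(x) for every      *)
(* p-primitive x.  Take a crossed homomorphism c from F_n to the functions      *)
(* P -> Q whose sums over the cosets of <z> vanish.  If x is p-primitive and    *)
(* x^k lies in R = ker rho, then c(x^k) is rho(x)-invariant, hence z-invariant, *)
(* hence zero; so c|R kills the p-primitive part of H_1(R; Q).  If c(x_1) = 0   *)
(* and c(x_2) = v, then c([x_2, x_1^m]) = v - z v, where rho(x_1)^m = z, so c|R *)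
(* is nonzero for a suitable v.                                                 *)
(*                                                                              *)
(* To find rho, let q = p^n, let K be the field with p^q elements and choose    *)
(* a_1, ..., a_n in K linearly independent over F_p.  Send x_i to the unipotent *)
(* (q+1) x (q+1) matrix over K with superdiagonal (a_i^(p^t)), t < q.  If x has *)
(* exponent sums e_i mod p, then rho(x) = 1 + N is unitriangular with           *)
(* superdiagonal (a^(p^t)), where a = sum_i e_i a_i, so rho(x)^q = 1 + N^q is   *)
(* the identity plus N_{K/F_p}(a) in the upper right corner.  For x p-primitive *)
(* a is nonzero, and some power of rho(x) is the central matrix z with corner   *)
(* entry 1.                                                                     *)

Require Import Defs.
From HB Require Import structures.
From mathcomp Require Import all_boot all_order all_algebra all_fingroup all_solvable.
From mathcomp Require Import finfield.
From mathcomp Require Import boolp classical_sets cardinality.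
From mathcomp.multinomials Require Import monalg.

Set Implicit Arguments.
Unset Strict Implicit.
Unset Printing Implicit Defensive.

Import GRing.Theory VectorInternalTheory.
Local Open Scope group_scope.

(** * Kernels of homomorphisms from a free group to a finite group *)

(** It suffices to find a nonzero additive map [R -> rat] that kills every [x ^+ k] in [R] with [x]
    p-primitive ([H1_primitive_proper]). Let [R] be the kernel of a homomorphism rho from F_n to a
    finite p-group P. Since F_n is free, a crossed homomorphism c into the functions P -> Q can be
    prescribed on generators, and its value at 1 is additive on [R]. As x commutes with x^k, the
    function c(x^k) is constant along multiplication by powers of rho(x). If these powers include z,
    and c sums to zero along the orbits of z, then c(x^k) = 0, while a suitable commutator keeps c
    nonzero on [R] ([H1_primitive_free_kernel]).

    What remains is a P in which a single central z of order p is a power of rho(x) for all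
    p-primitive x at once. A norm form provides it: rho(x) is unitriangular, its superdiagonal lists
    the Frobenius conjugates of some a in K, and a is the image under an injective additive map of a
    vector over F_p representing the class of x ([rep_superdiag]). The q-th power of rho(x) has the
    norm of a as its only nontrivial entry ([unitriangularXq]); this norm is nonzero when a is, and
    lies in the prime field, so a further power is z ([rep_primitive_center]). *)

Lemma free_group_ind (X : choiceType) (P : free_group X -> Prop) :
  P 1 -> (forall u v, P u -> P v -> P (u * v)) -> (forall u, P u -> P u^-1) ->
  (forall x, P (free_gen x)) -> forall w, P w.
Proof.
move=> P1 PM PV Pgen; case=> s; elim: s => [|a s IHs] rs.
  by rewrite (_ : FreeWord rs = 1) //; apply: val_inj.
have ra : reduced [:: a] by [].
rewrite (_ : FreeWord rs = FreeWord ra * FreeWord (reduced_behead rs)); last first.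
  by apply: val_inj; rewrite /= push_cons.
apply: PM => //; case: a {rs} ra => x [] ra.
  by rewrite (_ : FreeWord ra = (free_gen x)^-1); [exact: PV | exact: val_inj].
by rewrite (_ : FreeWord ra = free_gen x); [exact: Pgen | exact: val_inj].
Qed.

Section FreeLift.
Variables (X : choiceType) (G : groupType) (f : X -> G).

Lemma free_lift1 : free_lift f 1 = 1.
Proof. by rewrite /free_lift big_nil. Qed.

Lemma free_liftV : {morph free_lift f : u / u^-1}.
Proof. by move=> u; apply: (mulgI (free_lift f u)); rewrite -free_liftM !mulgV free_lift1. Qed.

Lemma free_liftX m : {morph free_lift f : u / u ^+ m}.
Proof.
by move=> u; elim: m => [|m IHm]; rewrite ?expg0 ?free_lift1 // !expgS free_liftM IHm.
Qed.

Definition free_ker : {pred free_group X} := fun w => free_lift f w == 1.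

Lemma free_kerP w : reflect (free_lift f w = 1) (w \in free_ker).
Proof. exact: eqP. Qed.

Fact free_ker1 : 1 \in free_ker.
Proof. exact/free_kerP/free_lift1. Qed.

Fact free_kerM : mulg_closed free_ker.
Proof.
by move=> u v /free_kerP fu /free_kerP fv; apply/free_kerP; rewrite free_liftM fu fv mulg1.
Qed.

Fact free_kerV : invg_closed free_ker.
Proof. by move=> u /free_kerP fu; apply/free_kerP; rewrite free_liftV fu invg1. Qed.

Definition free_kernel : groupClosed (free_group X) :=
  HB.pack free_ker (isMul1Closed.Build _ free_ker free_ker1)
    (isMulClosed.Build _ free_ker free_kerM) (isInvClosed.Build _ free_ker free_kerV).

Lemma free_kernel_normal : normal_subgroup free_kernel.
Proof.
move=> x y /free_kerP fx; apply/free_kerP.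
by rewrite conjgE !free_liftM free_liftV fx mul1g mulVg.
Qed.

End FreeLift.

Section FiniteImage.
Variables (X : choiceType) (gT : finGroupType) (f : X -> gT).

Definition free_image : {set gT} := [set g | `[< exists w, free_lift f w = g >]].

Lemma free_imageP g : reflect (exists w, free_lift f w = g) (g \in free_image).
Proof. by rewrite inE; apply: asboolP. Qed.

Lemma free_image_group_set : group_set free_image.
Proof.
apply/group_setP; split; first by apply/free_imageP; exists 1; exact: free_lift1.
move=> _ _ /free_imageP[u <-] /free_imageP[v <-].
by apply/free_imageP; exists (u * v); exact: free_liftM.
Qed.

Canonical free_image_group := Group free_image_group_set.

(** The cosets of the kernel are the fibres of [free_lift f], hence are indexed by the image. *)
Lemma card_lcosets_free_kernel :
  (Defs.lcosets (free_kernel f) #= `I_#|free_image|)%card.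
Proof.
pose coset (g : gT) : set (free_group X) := [set w | free_lift f w = g]%classic.
have cosetE u :
    [set u * x | x in [set x | x \in free_ker f]]%classic = coset (free_lift f u).
  apply/seteqP; split=> [_ [x /free_kerP fx <-]|w fw] /=.
    by rewrite /coset /= free_liftM fx mulg1.
  exists (u^-1 * w); last by rewrite mulgA mulgV mul1g.
  by apply/free_kerP; rewrite free_liftM free_liftV fw mulVg.
pose I : set gT := [set g | g \in free_image]%classic.
have lE : Defs.lcosets (free_kernel f) = [set coset g | g in I]%classic.
  apply/seteqP; split=> [_ [u _ <-]|_ [_ /free_imageP[u <-] <-]].
    by exists (free_lift f u); [apply/free_imageP; exists u | rewrite cosetE].
  by exists u; rewrite // cosetE.
rewrite lE; apply: (@card_eq_trans _ _ _ _ I).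
  apply: inj_card_eq => g h gI _ /=; rewrite inE /= in gI.
  case/free_imageP: gI => u fu e; have : coset g u by [].
  by rewrite e /coset /= fu.
have -> : I = [set enum_val i | i in [set: 'I_#|free_image|]]%classic.
  apply/seteqP; split=> [g gI|_ [i _ <-]]; last exact: enum_valP.
  by exists (enum_rank_in gI g); rewrite // enum_rankK_in.
apply: card_eq_trans (card_esym card_II).
by apply: inj_card_eq => i j _ _; apply: enum_val_inj.
Qed.

(** By Cauchy's theorem every prime dividing the order of the image is the order of one of its
    elements, and that order divides a power of p. *)
Lemma free_kernel_pgroup (p : nat) : prime p ->
  (forall w, exists e, free_lift f w ^+ (p ^ e) = 1) ->
  pgroup_quotient (free_kernel f) p.
Proof.
move=> p_pr fX; exists #|free_image|; first exact: card_lcosets_free_kernel.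
apply/(pgroupP (G := free_image_group)) => q q_pr /(Cauchy q_pr)[x /free_imageP[w <-] xq].
have [e /eqP] := fX w; rewrite -order_dvdn xq Euclid_dvdX // dvdn_prime2 //.
by case/andP=> /eqP-> _; rewrite inE.
Qed.

End FiniteImage.

Local Open Scope ring_scope.

(** * Functionals on first homology *)

Section ScalarH1.
Variables (K : fieldType).

Lemma lspan_scalar0 (V : lmodType K) (f : V -> K) (A : set V) : scalar f ->
  (forall v, A v -> f v = 0) -> forall v, lspan A v -> f v = 0.
Proof.
move=> fL fA _ [m [a [x [Ax ->]]]].
pose F : {scalar V} := HB.pack f (GRing.isLinear.Build _ _ _ _ f fL).
rewrite -[LHS]/(F _) linear_sum big1 // => i _.
by rewrite linearZ /= fA // mulr0.
Qed.

Variables (G : groupType) (phi : G -> K).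
Hypothesis phiM : forall g h, phi (g * h)%g = phi g + phi h.

Definition chain_eval : bar_chain1 K G -> K := mmap idfun phi.

Lemma chain_eval_gen g : chain_eval (bar_gen K g) = phi g.
Proof. by rewrite /chain_eval mmapU mul1r. Qed.

Fact chain_eval_is_linear : scalar chain_eval.
Proof.
move=> c u v; rewrite /chain_eval mmapD; congr (_ + _).
rewrite (mmapEw (msuppZ_le _ _)) mmapE big_distrr /=.
by apply: eq_bigr => k _; rewrite mcoeffZ mulrA.
Qed.

HB.instance Definition _ := GRing.isLinear.Build K (bar_chain1 K G) K _ chain_eval
  chain_eval_is_linear.

Definition H1_eval (c : H1 K G) : K := chain_eval (generic_quotient.repr c).

(** The representative chosen in [H1_eval] does not matter: additivity of [phi] makes [chain_eval]
    vanish on boundaries. *)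
Lemma H1_eval_proj v : H1_eval (quot_proj (@bar_boundaries K G) v) = chain_eval v.
Proof.
apply/eqP; rewrite -subr_eq0 -linearB; apply/eqP.
apply: (lspan_scalar0 chain_eval_is_linear) (quot_projK _ _) => _ [[g h] _ <-] /=.
by rewrite linearD linearB /= !chain_eval_gen phiM addrAC [phi h + _]addrC subrr.
Qed.

Lemma H1_eval_class g : H1_eval (H1_class K g) = phi g.
Proof. by rewrite H1_eval_proj chain_eval_gen. Qed.

Lemma H1_eval_is_linear : scalar H1_eval.
Proof.
move=> c u v; rewrite -(quot_reprK u) -(quot_reprK v) -linearP.
by rewrite !H1_eval_proj linearP.
Qed.

End ScalarH1.

Lemma H1_primitive_proper n p (R : groupClosed (free_group 'I_n))
    (phi : subgroup R -> rat) :
    (forall r s, phi (r * s)%g = phi r + phi s) ->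
    (forall x k (xkR : (x ^+ k)%g \in R), p_primitive p x -> phi (Sub (x ^+ k)%g xkR) = 0) ->
    (exists r, phi r != 0) ->
  H1_primitive p R <> [set: H1 rat (subgroup R)]%classic.
Proof.
move=> phiM phi0 [r /eqP phir] H1T; case: phir.
have Pr : H1_primitive p R (H1_class rat r) by rewrite H1T.
rewrite -(H1_eval_class phiM); apply: (lspan_scalar0 (H1_eval_is_linear phiM) _ Pr).
by move=> _ [x [k [xkR [xP _ ->]]]]; rewrite H1_eval_class // phi0.
Qed.

(** * Crossed homomorphisms into functions on a finite group *)

Section TranslationGroup.
Variable gT : finGroupType.

(* The semidirect product for the action (g . u)(s) = u (s g). *)
Definition translation_group : predArgType := (gT * {ffun gT -> rat})%type.

HB.instance Definition _ := Choice.on translation_group.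

Implicit Types a b : translation_group.

Definition tr_mul a b : translation_group :=
  ((a.1 * b.1)%g, [ffun s => a.2 s + b.2 (s * a.1)%g]).
Definition tr_one : translation_group := (1%g, [ffun=> 0]).
Definition tr_inv a : translation_group := (a.1^-1%g, [ffun s => - a.2 (s * a.1^-1)%g]).

Fact tr_mulA : associative tr_mul.
Proof.
move=> a b c; congr (_, _); first by rewrite /= mulgA.
by apply/ffunP => s; rewrite !ffunE /= mulgA addrA.
Qed.

Fact tr_mul1 : left_id tr_one tr_mul.
Proof.
case=> g u; congr (_, _); first by rewrite /= mul1g.
by apply/ffunP => s; rewrite !ffunE /= mulg1 add0r.
Qed.

Fact tr_mulr1 : right_id tr_one tr_mul.
Proof.
case=> g u; congr (_, _); first by rewrite /= mulg1.
by apply/ffunP => s; rewrite !ffunE /= addr0.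
Qed.

Fact tr_mulV : left_inverse tr_one tr_inv tr_mul.
Proof.
case=> g u; congr (_, _); first by rewrite /= mulVg.
by apply/ffunP => s; rewrite !ffunE /= addNr.
Qed.

Fact tr_mulrV : right_inverse tr_one tr_inv tr_mul.
Proof.
case=> g u; congr (_, _); first by rewrite /= mulgV.
by apply/ffunP => s; rewrite !ffunE /= mulgK addrN.
Qed.

HB.instance Definition _ := isGroup.Build translation_group
  tr_mulA tr_mul1 tr_mulr1 tr_mulV tr_mulrV.

End TranslationGroup.

Section CrossedHom.
Variables (X : choiceType) (gT : finGroupType) (f : X -> gT) (v : X -> {ffun gT -> rat}).

Let rho := free_lift f.

(** A crossed homomorphism is the second component of a homomorphism to the semidirect product, so
    the universal property of the free group yields one with arbitrary values [v] on the
    generators. *)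
Definition crossed_hom (w : free_group X) : {ffun gT -> rat} :=
  (free_lift (fun x => (f x, v x) : translation_group gT) w).2.

Local Notation c := crossed_hom.

Lemma crossed_hom_lift1 w :
  (free_lift (fun x => (f x, v x) : translation_group gT) w).1 = rho w.
Proof.
move: w; apply: free_lift_unique => [u w|x]; last by rewrite free_lift_gen.
by rewrite free_liftM.
Qed.

Lemma crossed_hom_gen x : c (free_gen x) = v x.
Proof. by rewrite /c free_lift_gen. Qed.

Lemma crossed_hom1 s : c 1%g s = 0.
Proof. by rewrite /c free_lift1 ffunE. Qed.

Lemma crossed_homM u w s : c (u * w)%g s = c u s + c w (s * rho u)%g.
Proof. by rewrite /c free_liftM ffunE -crossed_hom_lift1. Qed.

Lemma crossed_homV u s : c u^-1%g s = - c u (s * (rho u)^-1)%g.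
Proof. by rewrite /c free_liftV ffunE -crossed_hom_lift1. Qed.

Lemma crossed_homX0 u m : c u = [ffun=> 0] -> forall s, c (u ^+ m)%g s = 0.
Proof.
move=> cu0; elim: m => [|m IHm] s; first by rewrite expg0 crossed_hom1.
by rewrite expgS crossed_homM IHm addr0 cu0 ffunE.
Qed.

(** Expand c(x^(k+1)) both as c(x x^k) and as c(x^k x) and compare. *)
Lemma crossed_hom_ker_invariant x k m s : rho (x ^+ k)%g = 1%g ->
  c (x ^+ k)%g (s * rho x ^+ m)%g = c (x ^+ k)%g s.
Proof.
move=> xk1; elim: m s => [|m IHm] s; first by rewrite expg0 mulg1.
rewrite expgS mulgA IHm; apply: (addrI (c x s)).
by rewrite -crossed_homM -expgS expgSr crossed_homM xk1 mulg1 addrC.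
Qed.

(** Summation along the orbits of z commutes with translation by the image, because z does; so its
    vanishing propagates from the generators to all words. *)
Lemma crossed_hom_norm0 (z : gT) p :
    (forall w, commute z (rho w)) ->
    (forall x s, \sum_(i < p) v x (s * z ^+ i)%g = 0) ->
  forall w s, \sum_(i < p) c w (s * z ^+ i)%g = 0.
Proof.
move=> zC vz w; have swapE u s i : (s * z ^+ i * rho u = s * rho u * z ^+ i)%g.
  by rewrite -!mulgA; congr (s * _)%g; apply: commuteX2 1%N _; rewrite /commute zC.
elim/free_group_ind: w => [|u w IHu IHw|u IHu|x] s.
- by rewrite big1 // => i _; apply: crossed_hom1.
- under eq_bigr do rewrite crossed_homM swapE.
  by rewrite big_split /= IHu IHw addr0.
- under eq_bigr do rewrite crossed_homV -free_liftV swapE.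
  by rewrite sumrN IHu oppr0.
- by under eq_bigr do rewrite crossed_hom_gen; apply: vz.
Qed.

End CrossedHom.

Lemma H1_primitive_free_kernel n p (gT : finGroupType) (f : 'I_n -> gT) (z : gT)
    (i0 i1 : 'I_n) :
    (0 < p)%N -> z != 1%g -> (z ^+ p)%g = 1%g -> i0 != i1 ->
    (exists m, (f i0 ^+ m)%g = z) ->
    (forall w, commute z (free_lift f w)) ->
    (forall w, p_primitive p w -> exists m, (free_lift f w ^+ m)%g = z) ->
  H1_primitive p (free_kernel f)
    <> [set: H1 rat (subgroup (free_kernel f))]%classic.
Proof.
move=> p_gt0 z1 zp i01 [m0 fm0] zC prim_z.
(* [v0] is the indicator of 1 minus that of z^-1, a difference of z-translates, so its sums over the
   orbits of z telescope to 0. *)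
pose v0 : {ffun gT -> rat} := [ffun s => (s == 1%g)%:R - ((s * z)%g == 1%g)%:R].
pose v i := if i == i1 then v0 else [ffun=> 0].
have cz := crossed_hom_norm0 zC (v := v) (p := p).
have {}cz w s : \sum_(i < p) crossed_hom f v w (s * z ^+ i)%g = 0.
  apply: cz => x t; rewrite /v; case: eqP => _; last by rewrite big1 // => i; rewrite ffunE.
  under eq_bigr do rewrite ffunE -mulgA -expgSr -opprB.
  pose F i : rat := ((t * z ^+ i)%g == 1%g)%:R.
  rewrite sumrN -(big_mkord xpredT (fun i => F i.+1 - F i)).
  by rewrite telescope_sumr // /F zp expg0 subrr oppr0.
apply: (@H1_primitive_proper n p (free_kernel f)
  (fun r => crossed_hom f v (val r) 1%g)).
- case=> u uR [w wR] /=; rewrite crossed_homM.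
  by have /free_kerP -> := uR; rewrite mulg1.
- move=> x k xkR /prim_z[m fxm] /=; have /free_kerP xk1 := xkR.
  have cinv i : crossed_hom f v (x ^+ k)%g (1 * z ^+ i)%g = crossed_hom f v (x ^+ k)%g 1%g.
    by rewrite -fxm -expgM crossed_hom_ker_invariant.
  have := cz (x ^+ k)%g 1%g; under eq_bigr do rewrite cinv.
  rewrite sumr_const card_ord => /eqP.
  by rewrite Num.Theory.mulrn_eq0 gtn_eqF // => /eqP.
(* [b] lies over the central element z and has c(b) = 0, so the commutator of [a] and [b] is in the
   kernel, with c-value v0(1) - v0(z) at 1. *)
pose a := free_gen i1; pose b := (free_gen i0 ^+ m0)%g.
have rb : free_lift f b = z by rewrite free_liftX free_lift_gen.
have cb : forall s, crossed_hom f v b s = 0.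
  by apply: crossed_homX0; rewrite crossed_hom_gen /v (negPf i01).
have abR : (a * b * a^-1 * b^-1)%g \in free_kernel f.
  by apply/free_kerP; rewrite !free_liftM !free_liftV rb -(zC a) mulgK mulgV.
exists (Sub (a * b * a^-1 * b^-1)%g abR : subgroup (free_kernel f)).
rewrite SubK; set g := crossed_hom f v _; rewrite /= {}/g.
rewrite !crossed_homM !crossed_homV !cb !free_liftM rb -(zC a) crossed_hom_gen.
(* The value is 1 + [z^2 = 1], which is 1 or 2. *)
rewrite /v eqxx !ffunE !mul1g !mulgK eqxx (negPf z1) sub0r opprK !subr0.
by rewrite -natrD Num.Theory.pnatr_eq0.
Qed.

(** * Unitriangular matrices in characteristic p *)

Lemma exprp1D_comm (R : nzRingType) p (x : R) e : p \in [pchar R] ->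
  (1 + x) ^+ (p ^ e) = 1 + x ^+ (p ^ e).
Proof.
move=> pR; elim: e => [|e IHe]; first by rewrite !expr1.
rewrite expnSr !exprM IHe -!(pFrobenius_autE pR) pFrobenius_autD_comm ?pFrobenius_aut1 //.
exact/commr_sym/commr1.
Qed.

(** The p distinct elements [k%:R], k < p, already exhaust the roots of X^p - X. *)
Lemma exprp_id_natr (K : fieldType) p (c : K) :
  p \in [pchar K] -> c ^+ p = c -> exists m, c = m%:R.
Proof.
move=> pK cp; have p_pr := pcharf_prime pK; have p_gt1 := prime_gt1 p_pr.
pose rs := [seq k%:R : K | k <- iota 0 p].
suff /mapP[m _ ->] : c \in rs by exists m.
apply: contraT => c_rs.
have szP : size ('X^p - 'X : {poly K}) = p.+1.
  by rewrite size_polyDl ?size_polyXn // size_polyN size_polyX.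
suff : (size (c :: rs) < p.+1)%N by rewrite /= size_map size_iota ltnn.
rewrite -szP; apply: max_poly_roots; first by rewrite -size_poly_gt0 szP.
  apply/allP=> x; rewrite inE rootE !hornerE => /predU1P[->|/mapP[k _ ->]].
    by rewrite cp subrr.
  by rewrite -(pFrobenius_autE pK) pFrobenius_aut_nat subrr.
rewrite cons_uniq c_rs map_inj_in_uniq ?iota_uniq // => i j.
rewrite !mem_iota !add0n /= => ip jp.
wlog ij : i j ip jp / (i <= j)%N => [IH e|/eqP].
  by case/orP: (leq_total i j) => l; [|apply/esym]; apply: IH.
rewrite eq_sym -subr_eq0 -natrB // -(dvdn_pcharf pK) => /dvdnP[[|k] e].
  by apply/eqP; rewrite eqn_leq ij -subn_eq0 e.
have : (j - i < p)%N := leq_ltn_trans (leq_subr _ _) jp.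
by rewrite e mulSn ltnNge leq_addr.
Qed.

Lemma rV_embedding (F : fieldType) (V : vectType F) n : (n <= dim V)%N ->
  exists2 l : 'rV[F]_n -> V, {morph l : x y / x + y} & injective l.
Proof.
move=> nV; exists (fun x => r2v (x *m pid_mx n)) => [x y|x y /(can_inj r2vK)].
  by rewrite mulmxDl linearD.
move=> e; have {e} := congr1 (fun v => v *m (pid_mx n : 'M[F]_(dim V, n))) e.
by rewrite -!mulmxA pid_mx_id // pid_mx_1 !mulmx1.
Qed.

Lemma finField_embedding p n q : prime p -> (n <= q)%N -> (0 < q)%N ->
  exists (K : finFieldType) (l : 'rV['F_p]_n -> K),
    [/\ p \in [pchar K], #|K| = (p ^ q)%N, {morph l : x y / x + y}
      & injective l].
Proof.
move=> p_pr nq q_gt0; have [K pK cK] := pPrimePowerField p_pr q_gt0.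
pose V : vectType 'F_p := pPrimeCharType pK.
have [|l lD l_inj] := @rV_embedding _ V n; last by exists K, l.
by rewrite -dimvf pprimeChar_dimf cK pfactorK.
Qed.

(** The product is the norm of a to the prime field: raising to the power p permutes its factors
    cyclically, since a^(p^q) = a. *)
Lemma frobenius_norm_fixed (K : finFieldType) p q (a : K) : p \in [pchar K] ->
    #|K| = (p ^ q)%N ->
  (\prod_(t < q) a ^+ (p ^ t)) ^+ p = \prod_(t < q) a ^+ (p ^ t).
Proof.
move=> pK cK; have [->|a0] := eqVneq a 0.
  have p0 := prime_gt0 (pcharf_prime pK).
  case: q cK => [|q] _; first by rewrite !big_ord0 expr1n.
  by rewrite big_ord_recl expn0 expr1 mul0r expr0n gtn_eqF.
apply: (mulfI a0); rewrite -prodrXl.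
have -> : a * \prod_(t < q) (a ^+ (p ^ t)) ^+ p = \prod_(t < q.+1) a ^+ (p ^ t).
  by rewrite big_ord_recl expr1; congr (_ * _); apply: eq_bigr => t _; rewrite -exprM -expnSr.
by rewrite big_ord_recr /= mulrC -cK expf_card.
Qed.

Section Unitriangular.
Variables (R : comNzRingType) (q : nat).
Implicit Types (M N : 'M[R]_q.+1) (s t : nat -> R).

(* [s] is the superdiagonal; [s i] is irrelevant for [q <= i]. *)
Definition unitriangular s M : Prop := forall i j : 'I_q.+1,
  [/\ (j < i)%N -> M i j = 0, i = j -> M i j = 1 & j = i.+1 :> nat -> M i j = s i].

Lemma unitriangular1 : unitriangular (fun=> 0) 1%:M.
Proof.
move=> i j; rewrite mxE -val_eqE /=; split=> [ji|->|->]; last by rewrite ltn_eqF.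
  by rewrite gtn_eqF.
by rewrite eqxx.
Qed.

Lemma unitriangularM s t M N : unitriangular s M -> unitriangular t N ->
  unitriangular (fun i => s i + t i) (M * N).
Proof.
move=> uM uN i j; rewrite mxE; split=> [ji|<-|ji].
- rewrite big1 // => l _; have [li|il] := ltnP l i.
    by have [-> //] := uM i l; rewrite mul0r.
  by have [-> //] := uN l j; rewrite ?mulr0 // (leq_trans ji).
- rewrite (bigD1 i) //= big1 ?addr0 => [|l]; last rewrite neq_ltn => /orP[li|il].
  + by have [_ -> //] := uM i i; have [_ -> //] := uN i i; rewrite mulr1.
  + by have [-> //] := uM i l; rewrite mul0r.
  + by have [-> //] := uN l i; rewrite mulr0.
have ij : i != j by rewrite -val_eqE /= ji ltn_eqF.
rewrite (bigD1 i) // (bigD1 j) 1?eq_sym //= big1 => [|l /andP[li lj]].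
  have [_ -> // _] := uM i i; have [_ _ -> //] := uN i j.
  by have [_ _ -> //] := uM i j; have [_ -> // _] := uN j j; rewrite mul1r mulr1 addr0 addrC.
have [l_i|i_l] := ltnP l i; first by have [-> //] := uM i l; rewrite mul0r.
have [-> //] := uN l j; rewrite ?mulr0 //.
by rewrite ltn_neqAle [X in ~~ X && _]eq_sym lj ji ltn_neqAle [X in ~~ X && _]eq_sym li.
Qed.

Lemma unitriangularX s M m : unitriangular s M ->
  unitriangular (fun i => s i *+ m) (M ^+ m).
Proof.
move=> uM; elim: m => [|m IHm]; first by rewrite expr0; exact: unitriangular1.
rewrite exprS; have := unitriangularM uM IHm.
by under [X in unitriangular X]funext do rewrite -mulrS.
Qed.

(** Each factor [M - 1] moves up at least one diagonal; on the k-th diagonal only the path i, i+1,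
    ..., j contributes. *)
Lemma subr1_unitriangularX s M k : unitriangular s M -> forall i j : 'I_q.+1,
  ((j < i + k)%N -> ((M - 1) ^+ k) i j = 0) /\
  (j = (i + k)%N :> nat -> ((M - 1) ^+ k) i j = \prod_(i <= r < j) s r).
Proof.
move=> uM; have sub0 (i j : 'I_q.+1) : (j <= i)%N -> (M - 1) i j = 0.
  rewrite leq_eqVlt !mxE => /predU1P[/val_inj->|ji].
    by have [_ ->] := uM i i; rewrite // eqxx subrr.
  by have [-> //] := uM i j; rewrite -val_eqE gtn_eqF ?subr0.
elim: k => [|k IHk] i j.
  rewrite expr0 addn0 mxE -val_eqE; split=> [ji|/= <-]; first by rewrite gtn_eqF.
  by rewrite big_geq // eqxx.
rewrite exprS mxE; split=> [jik|jik].
  rewrite big1 // => l _; have [li|il] := leqP l i; first by rewrite sub0 ?mul0r.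
  rewrite (IHk l j).1 ?mulr0 //; apply: leq_trans jik _.
  by rewrite addnS -addSn leq_add2r.
have ij : (i < j)%N by rewrite jik addnS ltnS leq_addr.
pose i' := Ordinal (leq_ltn_trans ij (ltn_ord j)).
rewrite (bigD1 i') //= big1 ?addr0 => [|l li'].
  rewrite (IHk i' j).2 /=; last by rewrite jik addnS.
  rewrite [RHS]big_ltn //; congr (_ * _).
  by have [_ _ e] := uM i i'; rewrite !mxE e // -val_eqE ltn_eqF ?subr0 /=.
have [li|il] := leqP l i; first by rewrite sub0 ?mul0r.
rewrite (IHk l j).1 ?mulr0 // jik addnS -addSn ltn_add2r ltn_neqAle il andbT.
by rewrite eq_sym.
Qed.

Definition corner (c : R) : 'M[R]_q.+1 := 1 + c *: delta_mx ord0 ord_max.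

Lemma mul_delta_unitriangular s M : unitriangular s M ->
  delta_mx ord0 ord_max * M = delta_mx ord0 ord_max.
Proof.
move=> uM; apply/matrixP=> i j; rewrite mxE (bigD1 ord_max) //= big1 ?addr0 => [|l lm].
  rewrite !mxE eqxx andbT; case: (i == ord0); rewrite ?mul0r //= mul1r.
  have [-> |jm] := eqVneq j ord_max; first by have [_ -> //] := uM ord_max ord_max.
  have [-> //] := uM ord_max j; rewrite ltn_neqAle -ltnS ltn_ord andbT.
  by apply: contraNneq jm => e; apply/eqP/val_inj.
by rewrite mxE (negPf lm) andbF mul0r.
Qed.

Lemma unitriangular_mul_delta s M : unitriangular s M ->
  M * delta_mx ord0 ord_max = delta_mx ord0 ord_max.
Proof.
move=> uM; apply/matrixP=> i j; rewrite mxE (bigD1 ord0) //= big1 ?addr0 => [|l l0].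
  rewrite !mxE eqxx /=; case: (j == ord_max); rewrite ?andbF ?mulr0 //= andbT mulr1.
  have [->|i0] := eqVneq i ord0; first by have [_ -> //] := uM ord0 ord0.
  by have [-> //] := uM i ord0; rewrite lt0n.
by rewrite mxE (negPf l0) mulr0.
Qed.

Lemma comm_corner c s M : unitriangular s M -> GRing.comm (corner c) M.
Proof.
move=> uM; rewrite /GRing.comm /corner mulrDl mulrDr mul1r mulr1 -scalerAl -scalerAr.
by rewrite (mul_delta_unitriangular uM) (unitriangular_mul_delta uM).
Qed.

Lemma cornerD : (0 < q)%N -> {morph corner : c d / c + d >-> c * d}.
Proof.
move=> q_gt0 c d; rewrite /corner mulrDl !mulrDr !mul1r mulr1 -scalerAl -scalerAr.
rewrite -[delta_mx _ _ * _]/(_ *m _) mul_delta_mx_0 -?val_eqE /= ?gtn_eqF //.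
by rewrite !scaler0 addr0 scalerDl addrAC addrA.
Qed.

Lemma cornerX c m : (0 < q)%N -> corner c ^+ m = corner (c *+ m).
Proof.
move=> q_gt0; elim: m => [|m IHm]; first by rewrite expr0 /corner scale0r addr0.
by rewrite exprS IHm -cornerD // mulrS.
Qed.

Lemma corner_eq1 c : corner c = 1 -> c = 0.
Proof.
move/(canRL (addKr _)); rewrite addNr => /matrixP/(_ ord0 ord_max).
by rewrite !mxE !eqxx mulr1.
Qed.

(* (1 + N)^q = 1 + N^q, and only the corner entry of N^q survives. *)
Lemma unitriangularXq p s M : p \in [pchar R] -> p.-nat q -> unitriangular s M ->
  M ^+ q = corner (\prod_(t < q) s t).
Proof.
move=> pR /p_natP[e qE] uM; have pM : p \in [pchar 'M[R]_q.+1]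
  by rewrite inE (pcharf_prime pR) -scaler_nat (pcharf0 pR) scale0r eqxx.
have -> : M ^+ q = 1 + (M - 1) ^+ q.
  by have := exprp1D_comm (M - 1) e pM; rewrite -qE addrC subrK.
congr (1 + _); apply/matrixP=> i j; rewrite !mxE.
have [N0 Nq] := subr1_unitriangularX q uM i j.
have [/andP[/eqP i0 /eqP jm]|ij] := boolP ((i == ord0) && (j == ord_max)).
  by rewrite mulr1 Nq i0 jm ?big_mkord.
rewrite mulr0 N0 //; move: ij; rewrite negb_and => /orP[i0|jm].
  by apply: leq_ltn_trans (leq_ord j) _; rewrite -[X in (X < _)%N]add0n ltn_add2r lt0n.
apply: (@leq_trans q); last exact: leq_addl.
by rewrite ltn_neqAle -ltnS ltn_ord andbT; apply: contraNneq jm => e'; apply/eqP/val_inj.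
Qed.

End Unitriangular.

(** * A representation of the free group over a finite field, with norms in the corner *)

Section UnitriangularRepresentation.
Variables (K : finFieldType) (p n q : nat) (l : 'rV['F_p]_n -> K).
Hypotheses (pK : p \in [pchar K]) (p_q : p.-nat q) (q_gt0 : (0 < q)%N) (cardK : #|K| = (p ^ q)%N).
Hypotheses (lD : {morph l : x y / x + y}) (l_inj : injective l).

Let p_gt0 : (0 < p)%N := prime_gt0 (pcharf_prime pK).

Lemma cornerXp (c : K) : corner q c ^+ p = 1.
Proof. by rewrite cornerX // (mulrn_pchar pK) /corner scale0r addr0. Qed.

Lemma unitriangularXqp s (M : 'M[K]_q.+1) : unitriangular s M -> M ^+ (q * p) = 1.
Proof. by move=> uM; rewrite exprM (unitriangularXq pK p_q uM) cornerXp. Qed.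

Definition superdiag (a : K) (t : nat) : K := a ^+ (p ^ t).

Lemma superdiagD a b t : superdiag (a + b) t = superdiag a t + superdiag b t.
Proof. by rewrite /superdiag exprDn_pchar // pnatX (pnatE _ (pcharf_prime pK)) pK. Qed.

Lemma embed0 : l 0 = 0.
Proof. by apply: (addrI (l 0)); rewrite -lD !addr0. Qed.

Definition superdiag_mx (a : K) : 'M[K]_q.+1 :=
  \matrix_(i, j) if j == i then 1 else superdiag a i *+ (j == i.+1 :> nat).

Lemma superdiag_mx_unitriangular a : unitriangular (superdiag a) (superdiag_mx a).
Proof.
move=> i j; rewrite mxE -val_eqE /=; split=> [ji|->|->].
- by rewrite ltn_eqF // ltn_eqF // ltnW.
- by rewrite eqxx.
- by rewrite gtn_eqF // eqxx.
Qed.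

Lemma superdiag_mx_unit a : superdiag_mx a \is a GRing.unit.
Proof.
rewrite -(@unitrX_pos _ _ (q * p)) ?muln_gt0 ?q_gt0 //.
by rewrite (unitriangularXqp (superdiag_mx_unitriangular a)) unitr1.
Qed.

Lemma corner_unit (c : K) : corner q c \is a GRing.unit.
Proof. by rewrite -(@unitrX_pos _ _ p) // cornerXp unitr1. Qed.

Definition rep_gen (i : 'I_n) : {unit 'M[K]_q.+1} :=
  FinRing.Unit (superdiag_mx_unit (l (delta_mx 0 i))).

Definition rep_center : {unit 'M[K]_q.+1} := FinRing.Unit (corner_unit 1).

(** One vector [x] governs both the mod p class and the superdiagonal of the image, so a nonzero
    class forces [l x != 0]; no basis of the mod p homology has to be established. Superdiagonals
    add under products because a -> a^(p^t) is additive. *)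
Lemma rep_superdiag w : exists2 x : 'rV['F_p]_n,
    H1_class 'F_p w = \sum_i x 0 i *: H1_class 'F_p (free_gen i)
  & unitriangular (superdiag (l x)) (val (free_lift rep_gen w)).
Proof.
have class1 : H1_class 'F_p (1%g : free_group 'I_n) = 0.
  by apply: (addrI (H1_class 'F_p 1%g)); rewrite -H1_classM mulg1 addr0.
elim/free_group_ind: w => [|u v [x cu uu] [y cv uv]|u [x cu uu]|i].
- exists 0; first by rewrite class1 big1 // => i _; rewrite mxE scale0r.
  rewrite free_lift1 /= (_ : superdiag _ = fun=> 0); first exact: unitriangular1.
  by apply: funext => t; rewrite /superdiag embed0 expr0n expn_eq0 gtn_eqF.
- exists (x + y).
    rewrite H1_classM cu cv -big_split; apply: eq_bigr => i _.
    by rewrite mxE scalerDl.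
  rewrite free_liftM /= (_ : superdiag _ = fun t => superdiag (l x) t + superdiag (l y) t).
    exact: unitriangularM.
  by apply: funext => t; rewrite lD superdiagD.
- exists (- x).
    apply: (addrI (H1_class 'F_p u)); rewrite -H1_classM mulgV class1 cu -big_split big1 // => i _.
    by rewrite mxE scaleNr /= addrN.
  have uX : (free_lift rep_gen u ^+ (q * p) = 1)%g.
    by apply: val_inj; rewrite FinRing.val_unitX (unitriangularXqp uu).
  (* The inverse is written as a positive power so that [unitriangularX] gives its superdiagonal. *)
  have -> : free_lift rep_gen u^-1%g = (free_lift rep_gen u ^+ (q * p).-1)%g.
    rewrite free_liftV; apply: (mulgI (free_lift rep_gen u)).
    by rewrite mulgV -expgS prednK ?muln_gt0 ?q_gt0.
  rewrite FinRing.val_unitX (_ : superdiag _ = fun t => superdiag (l x) t *+ (q * p).-1).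
    exact: unitriangularX.
  apply: funext => t; apply: (addrI (superdiag (l x) t)).
  rewrite -superdiagD -lD addrN -mulrS prednK ?muln_gt0 ?q_gt0 //.
  rewrite mulrnA (mulrn_pchar pK) embed0 /superdiag expr0n expn_eq0 gtn_eqF //.
- exists (delta_mx 0 i); last by rewrite free_lift_gen; exact: superdiag_mx_unitriangular.
  rewrite (bigD1 i) //= big1 ?addr0 => [|j ji]; first by rewrite mxE !eqxx scale1r.
  by rewrite mxE (negPf ji) andbF scale0r.
Qed.

Lemma rep_expn w : (free_lift rep_gen w ^+ (q * p) = 1)%g.
Proof.
have [x _ ux] := rep_superdiag w.
by apply: val_inj; rewrite FinRing.val_unitX (unitriangularXqp ux).
Qed.

Lemma rep_center_comm w : commute rep_center (free_lift rep_gen w).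
Proof.
have [x _ ux] := rep_superdiag w.
by apply: val_inj; rewrite !FinRing.val_unitM; exact: comm_corner ux.
Qed.

(* The corner entry of [u ^+ q] is the norm of [a], which lies in the prime field. *)
Lemma unitriangular_power_center a (u : {unit 'M[K]_q.+1}) : a != 0 ->
  unitriangular (superdiag a) (val u) -> exists m, (u ^+ m)%g = rep_center.
Proof.
move=> a0 ua; set c := \prod_(t < q) a ^+ (p ^ t).
have c0 : c != 0 by apply/prodf_neq0 => t _; rewrite expf_neq0.
have [m cm] : exists m, c^-1 = m%:R.
  by apply: exprp_id_natr pK _; rewrite exprVn frobenius_norm_fixed.
(* The corner entry of [u ^+ q] is c, and m times c is 1. *)
exists (q * m)%N; apply: val_inj; rewrite FinRing.val_unitX exprM.
by rewrite (unitriangularXq pK p_q ua) cornerX // -mulr_natl -cm mulVf.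
Qed.

Lemma rep_gen_center i : exists m, (rep_gen i ^+ m)%g = rep_center.
Proof.
apply: (@unitriangular_power_center (l (delta_mx 0 i))); last exact: superdiag_mx_unitriangular.
rewrite -embed0 (inj_eq l_inj); apply/eqP => /matrixP/(_ 0 i)/eqP.
by rewrite !mxE !eqxx oner_eq0.
Qed.

Lemma rep_primitive_center w : p_primitive p w ->
  exists m, (free_lift rep_gen w ^+ m)%g = rep_center.
Proof.
have [x cx ux] := rep_superdiag w => w0.
apply: (unitriangular_power_center _ ux); rewrite -embed0 (inj_eq l_inj).
apply: contraNneq w0 => x0; rewrite cx x0 big1 // => i _.
by rewrite mxE scale0r.
Qed.

End UnitriangularRepresentation.

Theorem theorem4 (n p : nat) (n_ge2 : (2 <= n)%N) (p_prime : prime p) :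
  exists R : groupClosed (free_group 'I_n),
    [/\ normal_subgroup R,
        finite_index R,
        H1_primitive p R <> [set: H1 rat (subgroup R)]%classic
      & pgroup_quotient R p].
Proof.
(* A power of p, so that (1 + N)^q = 1 + N^q, and at least n, so that F_p^n embeds in the field with
   p^q elements. *)
pose q := (p ^ n)%N.
have q_gt0 : (0 < q)%N by rewrite expn_gt0 prime_gt0.
have p_q : p.-nat q by rewrite pnatX pnat_id.
have nq : (n <= q)%N by apply: ltnW; apply: ltn_expl; apply: prime_gt1.
have [K [l [pK cK lD l_inj]]] := finField_embedding p_prime nq q_gt0.
pose f := rep_gen l pK p_q q_gt0; pose z := rep_center pK q_gt0.
have pq : pgroup_quotient (free_kernel f) p.
  apply: free_kernel_pgroup p_prime _ => w; exists n.+1.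
  by rewrite expnSr; exact: rep_expn.
exists (free_kernel f); split; last exact: pq.
- exact: free_kernel_normal.
- by case: pq => m lm _; exists m.
pose i0 : 'I_n := Ordinal (ltnW n_ge2); pose i1 : 'I_n := Ordinal n_ge2.
apply: (@H1_primitive_free_kernel n p _ f z i0 i1).
- exact: prime_gt0.
- by apply/eqP=> /(congr1 val) /corner_eq1 /eqP; rewrite oner_eq0.
- by apply: val_inj; rewrite FinRing.val_unitX; exact: cornerXp.
- by [].
- exact: rep_gen_center.
- exact: rep_center_comm.
- exact: rep_primitive_center.
Qed.
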